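(* For every $n \in \mathbb{N}$, put $\delta_n := d_{2n+1} - 2d_n$, so that $d_{2n+1} = 2d_n + \delta_n$. Then for all $n \in \mathbb{N}$, $\delta_n \in \{0,2\}$ and $\delta_{2n+1} = \delta_n$.
   Context: $\mathbb{N}$ denotes the positive integers. For $n \in \mathbb{N}$, the $n \times n$ grid graph $G$ is the simple graph with vertex set $\{1,\dots,n\}^2$ in which $(i,j)$ and $(i',j')$ are adjacent if and only if $|i-i'| + |j-j'| = 1$. Let $A$ be its adjacency matrix, viewed as an $n^2 \times n^2$ matrix over the field $\mathbb{Z}_2$ with two elements, and let $I$ be the identity matrix. Define $d_n = \dim_{\mathbb{Z}_2} \ker(A + I)$. *)

(* Defs.v *)
From HB Require Import structures.
From mathcomp Require Import all_boot all_order all_algebra.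

Set Implicit Arguments.
Unset Strict Implicit.
Unset Printing Implicit Defensive.

Import GRing.Theory.
Local Open Scope ring_scope.

(* Vertices are 0-based: (i, j) : 'I_n * 'I_n stands for (i + 1, j + 1). *)
Definition grid_adj (n : nat) : rel ('I_n * 'I_n) :=
  fun u v => (`|(u.1 : nat) - (v.1 : nat)| + `|(u.2 : nat) - (v.2 : nat)| == 1)%N.

Definition adjmx (F : nzRingType) (T : finType) (e : rel T) : 'M[F]_#|T| :=
  \matrix_(i, j) (e (enum_val i) (enum_val j))%:R.

(* [kermx] is the kernel of the action on row vectors; the transpose turns it
   into the usual kernel {x | M x = 0} of the action on column vectors. *)
Definition nullity (F : fieldType) (m n : nat) (M : 'M[F]_(m, n)) : nat :=
  \rank (kermx M^T).

Definition d (n : nat) : nat := nullity (adjmx 'F_2 (@grid_adj n) + 1%:M).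

Definition delta (n : nat) : int := (d (2 * n + 1))%:Z - 2 * (d n)%:Z.

(* Main.v *)
Require Import Defs.
From HB Require Import structures.
From mathcomp Require Import all_boot all_order all_algebra.
From mathcomp Require Import zify ring.

(** Write P for the adjacency matrix of the path on n vertices, over a field of
    characteristic 2, and read a vector on the grid as an n x n matrix X.  The
    vector lies in the kernel of A + I exactly when P X + X P + X = 0, that is
    P X = X (P - 1): X intertwines P and P - 1.

    The first basis vector e is cyclic for P: the k-th basis vector is
    e F_k(P), where F_0 = 0, F_1 = 1 and F_(k+2) = x F_(k+1) + F_k, and e is
    annihilated by f = F_(n+1), of degree n.  An intertwiner is therefore
    determined by its first row e X, and this row can be any vector killed by
    f(P - 1) ([cyclic_intertwiner]).  Since row vectors form the module
    K[x] / (f) under the action of P, the kernel of f(P - 1) has dimension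
    deg gcd(f(x), f(x - 1)) ([rank_kermx_horner]).  Hence
    d_n = deg gcd(f(x), f(x - 1)) ([nullity_grid]).

    Passing from n to 2n + 1 replaces F_(n+1) by F_(2n+2), which in
    characteristic 2 equals x F_(n+1)^2 ([fib_double]).  Let s denote the
    involution p(x) |-> p(x - 1), and write f = g a with g = gcd(f, s f), so
    that s g = g and a is coprime to s a.  Then x f^2 = g^2 (x a^2) and
    s (x f^2) = g^2 ((x - 1) (s a)^2).  The cofactors x a^2 and (x - 1) (s a)^2
    can only share the factors x - 1 and x: the first is shared when x - 1
    divides a, and the second when x divides s a, which is the same condition.
    If a(1) <> 0, nothing more is common and the degree of the gcd exactly
    doubles.  If a(1) = 0, both x and x - 1 are common, each exactly once, so
    the degree gains 2.  In both cases the new cofactor vanishes at 1 if and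
    only if a does ([shift_split_double]); hence delta_n is 0 or 2, and it
    does not change when the step is repeated. *)

Set Implicit Arguments.
Unset Strict Implicit.
Unset Printing Implicit Defensive.

Import GRing.Theory.
Local Open Scope ring_scope.

(** * Cyclic matrices and intertwiners *)

Lemma rank_kermx_iso (F : fieldType) (m p m' p' : nat)
    (A : 'M[F]_(m, p)) (B : 'M[F]_(m', p')) (K : 'M[F]_(m, m')) :
    (forall u : 'rV_m, u *m A = 0 -> u *m K *m B = 0) ->
    (forall u : 'rV_m, u *m A = 0 -> u *m K = 0 -> u = 0) ->
    (forall v : 'rV_m', v *m B = 0 -> exists2 u, u *m A = 0 & v = u *m K) ->
  \rank (kermx A) = \rank (kermx B).
Proof.
move=> KB Kinj Ksurj.
have -> : \rank (kermx B) = \rank (kermx A *m K).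
  apply: eqmx_rank; apply/andP; split.
    apply/rV_subP=> v /sub_kermxP/Ksurj[u uA ->].
    by apply: submxMr; apply/sub_kermxP.
  apply/rV_subP=> _ /submxP[w ->]; rewrite mulmxA; apply/sub_kermxP/KB.
  by apply/sub_kermxP/submxMl.
apply/esym/mxrank_injP/rowV0P=> u; rewrite sub_capmx => /andP[].
by move=> /sub_kermxP uA /sub_kermxP uK; apply: Kinj.
Qed.

Lemma horner_mx_intertwine (F : fieldType) (n k : nat)
    (M : 'M[F]_n.+1) (N : 'M[F]_k.+1) (X : 'M[F]_(n.+1, k.+1)) (q : {poly F}) :
  M *m X = X *m N -> horner_mx M q *m X = X *m horner_mx N q.
Proof.
move=> MX; elim/poly_ind: q => [|q c IHq].
  by rewrite !rmorph0 mul0mx mulmx0.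
rewrite !rmorphD !rmorphM /= !horner_mx_X !horner_mx_C mulmxDl mulmxDr.
by rewrite -mulmxA MX !mulmxA IHq scalar_mxC.
Qed.

Lemma horner_mx_shift (F : fieldType) (n : nat) (M : 'M[F]_n.+1) (p : {poly F}) :
  horner_mx (M - 1) p = horner_mx M (p \Po ('X - 1%:P)).
Proof.
elim/poly_ind: p => [|q c IHq]; first by rewrite comp_poly0 !rmorph0.
rewrite comp_polyD comp_polyM comp_polyX comp_polyC !rmorphD !rmorphM /=.
by rewrite IHq rmorphB /= !horner_mx_X !horner_mx_C.
Qed.

Lemma mul_horner_mxM (F : fieldType) (n : nat) (M : 'M[F]_n.+1) (v : 'rV_n.+1)
    (p q : {poly F}) :
  v *m horner_mx M (p * q) = v *m horner_mx M p *m horner_mx M q.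
Proof. by rewrite rmorphM /= mulmxA. Qed.

(** The matrix with rows v, v M, ..., v M^(m-1): multiplying a row of
    coefficients by it evaluates the corresponding polynomial at M, applied to
    v. *)
Definition krylov (F : fieldType) (m n : nat) (v : 'rV[F]_n.+1) (M : 'M[F]_n.+1)
  : 'M_(m, n.+1) := powers_mx M m *m lin_mul_row v.

Lemma mul_krylov (F : fieldType) (m n : nat) (v : 'rV[F]_n.+1) (M : 'M[F]_n.+1)
    (u : 'rV_m) :
  u *m krylov m v M = v *m horner_mx M (rVpoly u).
Proof.
by rewrite mulmxA horner_rVpoly -[in LHS](vec_mxK (u *m _)) mul_vec_lin_row.
Qed.

(** Row vectors, acted on by M, form the module F[x] / (chi) with generator
    e; the size condition says that chi has degree the dimension. *)
Definition cyclic_with (F : fieldType) (n : nat) (M : 'M[F]_n.+1)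
    (e : 'rV[F]_n.+1) (chi : {poly F}) : Prop :=
  [/\ size chi = n.+2, e *m horner_mx M chi = 0 &
      forall w : 'rV_n.+1, exists q, w = e *m horner_mx M q].

Lemma horner_mx_modp (F : fieldType) (n : nat) (M : 'M[F]_n.+1)
    (v : 'rV[F]_n.+1) (chi q : {poly F}) :
  v *m horner_mx M chi = 0 ->
  v *m horner_mx M (q %% chi) = v *m horner_mx M q.
Proof.
move=> v0; rewrite [in RHS](divp_eq q chi) rmorphD /= mulmxDr.
by rewrite [_ %/ _ * _]mulrC mul_horner_mxM v0 mul0mx add0r.
Qed.

Section Cyclic.

Variables (F : fieldType) (n : nat) (M : 'M[F]_n.+1) (e : 'rV[F]_n.+1).
Variable (chi : {poly F}).
Hypothesis Mcyc : cyclic_with M e chi.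

Let size_chi : size chi = n.+2. Proof. by case: Mcyc. Qed.

Let chi_neq0 : chi != 0. Proof. by rewrite -size_poly_eq0 size_chi. Qed.

Let e_chi : e *m horner_mx M chi = 0. Proof. by case: Mcyc. Qed.

Let size_modp q : (size (q %% chi)%R <= n.+1)%N.
Proof. by rewrite -ltnS -size_chi ltn_modp. Qed.

(** Every vector is e q(M) with q reduced modulo chi, so the square Krylov
    matrix of e has full row space. *)
Lemma krylov_unit : krylov n.+1 e M \in unitmx.
Proof.
case: Mcyc => _ _ gen; rewrite -row_full_unit -sub1mx; apply/rV_subP=> w _.
have [q ->] := gen w; apply/submxP; exists (poly_rV (q %% chi)).
by rewrite mul_krylov poly_rV_K ?size_modp// horner_mx_modp.
Qed.

Lemma cyclic_annihilator q : (e *m horner_mx M q == 0) = (chi %| q).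
Proof.
apply/eqP/idP=> [|/dvdpP[r ->]]; last first.
  by rewrite mulrC mul_horner_mxM e_chi mul0mx.
rewrite -(horner_mx_modp q e_chi) -[q %% chi](poly_rV_K (size_modp q)).
rewrite -mul_krylov => /(congr1 (mulmx^~ (invmx (krylov n.+1 e M)))).
rewrite mulmxK ?krylov_unit// mul0mx => /(congr1 rVpoly).
by rewrite poly_rV_K ?size_modp// linear0 => /eqP.
Qed.

(** X has to send e q(M) to v q(N).  This is well defined because q matters
    only modulo chi on both sides, and it commutes with multiplication of q by
    the variable, which is the intertwining relation. *)
Lemma cyclic_intertwiner k (N : 'M[F]_k.+1) (v : 'rV_k.+1) :
    v *m horner_mx N chi = 0 ->
  exists2 X, M *m X = X *m N & e *m X = v.
Proof.
move=> v_chi.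
pose X := invmx (krylov n.+1 e M) *m krylov n.+1 v N.
have XE q : e *m horner_mx M q *m X = v *m horner_mx N q.
  rewrite -(horner_mx_modp q e_chi) -(horner_mx_modp q v_chi).
  rewrite -[q %% chi](poly_rV_K (size_modp q)) -!mul_krylov.
  by rewrite mulmxA mulmxK ?krylov_unit.
exists X; move: XE; clearbody X => XE; last first.
  by have := XE 1; rewrite !rmorph1 !mulmx1.
apply/row_matrixP=> i; rewrite !rowE.
case: Mcyc => _ _ /(_ (delta_mx 0 i))[q ->].
have eqM : e *m horner_mx M q *m M = e *m horner_mx M (q * 'X).
  by rewrite mul_horner_mxM horner_mx_X.
by rewrite !mulmxA eqM !XE mul_horner_mxM horner_mx_X.
Qed.

(** In F[x] / (chi), a class q is killed by p when chi divides p q, that is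
    when q is a multiple of h = chi / gcd(chi, p).  The multiples of h are
    parametrized by the polynomials r of degree below deg gcd(chi, p), through
    q = h r. *)
Lemma rank_kermx_horner p :
  \rank (kermx (horner_mx M p)) = (size (gcdp chi p)).-1.
Proof.
set g := gcdp chi p; set k := (size g).-1.
have g_neq0 : g != 0 by rewrite gcdp_eq0 negb_and chi_neq0.
pose h := chi %/ g; have chiE : chi = h * g by rewrite divpK ?dvdp_gcdl.
have h_neq0 : h != 0 by apply: contraNneq chi_neq0 => h0; rewrite chiE h0 mul0r.
have size_g : size g = k.+1 by rewrite prednK // size_poly_gt0.
have size_hg : (size h + k)%N = n.+2.
  by rewrite -size_chi chiE size_mul // size_g addnS.
have dvd_kerE q : (chi %| p * q) = (h %| q).
  rewrite {1}chiE -[p in p * q](divpK (dvdp_gcdr chi p)) -/g mulrAC dvdp_mul2r //.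
  rewrite Gauss_dvdpr //; apply: coprimep_div_gcd; by rewrite chi_neq0.
(* The space of all polynomials r is viewed as the kernel of a zero matrix. *)
have -> : k = \rank (kermx (0 : 'M[F]_(k, 1))) by rewrite mxrank_ker mxrank0 subn0.
symmetry; apply: (@rank_kermx_iso _ _ _ _ _ _ _ (krylov k (e *m horner_mx M h) M)).
- move=> u _; rewrite mul_krylov -!mul_horner_mxM.
  by apply/eqP; rewrite cyclic_annihilator mulrA mulrC dvd_kerE dvdp_mulr.
- move=> u _; rewrite mul_krylov -mul_horner_mxM.
  move/eqP; rewrite cyclic_annihilator chiE dvdp_mul2l // => /dvdp_leq leq_u.
  apply/eqP; rewrite -(inj_eq (can_inj rVpolyK)) linear0.
  apply: contraT => /leq_u.
  by rewrite size_g leqNgt ltnS size_poly.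
move=> w; case: (Mcyc) => _ _ /(_ w)[q ->].
rewrite -(horner_mx_modp q e_chi); set r := q %% chi.
rewrite -mul_horner_mxM => /eqP.
rewrite cyclic_annihilator mulrC dvd_kerE => /dvdpP[s rE].
exists (poly_rV s); first by rewrite mulmx0.
rewrite mul_krylov poly_rV_K; first by rewrite -mul_horner_mxM mulrC -rE.
have [->|s_neq0] := eqVneq s 0; first by rewrite size_poly0.
have := size_modp q; rewrite -/r rE size_mul //.
rewrite -[(size s <= k)%N](leq_add2l (size h)) size_hg.
by move: (size h) (size s) => a b; lia.
Qed.

End Cyclic.

(** * Fibonacci polynomials *)

(** Up to signs, which characteristic 2 does not see, [fib F n.+1] is the
    characteristic polynomial of the path on n vertices. *)
Fixpoint fib (F : fieldType) (n : nat) : {poly F} :=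
  match n with
  | 0 => 0
  | 1 => 1
  | (m.+1 as k).+1 => 'X * fib F k + fib F m
  end.

Lemma fibSS (F : fieldType) n : fib F n.+2 = 'X * fib F n.+1 + fib F n.
Proof. by []. Qed.

Lemma fibD (F : fieldType) m n :
  fib F (m + n.+1) = fib F m.+1 * fib F n.+1 + fib F m * fib F n.
Proof.
elim/ltn_ind: m => -[|[|m]] IH; first by rewrite add0n /=; ring.
  by rewrite add1n !fibSS /=; ring.
have E k : fib F (k.+2 + n.+1) = 'X * fib F (k.+1 + n.+1) + fib F (k + n.+1).
  by rewrite !addSn fibSS.
by rewrite E !IH// !fibSS; ring.
Qed.

Lemma size_fib (F : fieldType) n : size (fib F n) = n.
Proof.
elim/ltn_ind: n => -[|[|n]] IH; first by rewrite size_poly0.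
  by rewrite size_poly1.
have sizeX : size ('X * fib F n.+1) = n.+2.
  by rewrite mulrC size_mulX ?IH// -size_poly_eq0 IH.
by rewrite fibSS size_polyDl sizeX// IH.
Qed.

(** The addition formula gives F_(2m) = F_m (F_(m+1) + F_(m-1)), and in
    characteristic 2 the recurrence reads F_(m+1) + F_(m-1) = x F_m. *)
Lemma fib_double (F : fieldType) n :
  2 \in [pchar F] -> fib F (2 * n) = 'X * fib F n ^+ 2.
Proof.
move=> char2; case: n => [|n]; first by rewrite muln0 expr0n mulr0.
rewrite mul2n -addnn fibD fibSS.
have := addrr_pchar2 (etrans (pchar_poly F 2) char2) (fib F n * fib F n.+1).
by move=> E; ring: E.
Qed.

(** * The path and the grid *)

Lemma distn_eq1 (m n : nat) : (`|m - n| == 1)%N = (m == n.+1) || (n == m.+1).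
Proof. lia. Qed.

Definition path_adjmx (F : fieldType) (n : nat) : 'M[F]_n :=
  \matrix_(i, j) (`|(i : nat) - (j : nat)| == 1)%N%:R.

(** The basis row vectors, numbered from 1, with the value 0 at both 0 and
    n + 1.  With these two phantom vertices the relation
    e_k P = e_(k-1) + e_(k+1) also holds at the ends of the path. *)
Definition path_vertex (F : fieldType) (n k : nat) : 'rV[F]_n :=
  \row_j (k == j.+1)%:R.

Lemma path_vertex_adj (F : fieldType) n k : (k < n)%N ->
  path_vertex F n k.+1 *m path_adjmx F n
    = path_vertex F n k + path_vertex F n k.+2.
Proof.
move=> lt_kn; apply/rowP=> j; rewrite !mxE (bigD1 (Ordinal lt_kn)) //= !mxE.
rewrite eqxx mul1r big1 ?addr0 => [|i /eqP neq_ik]; last first.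
  rewrite !mxE; have [eq_ki|_] := eqVneq; last by rewrite mul0r.
  by case: neq_ik; apply: val_inj; case: eq_ki.
rewrite -natrD distn_eq1 /=; congr _%:R; move: (j : nat) => l; lia.
Qed.

(** Both sides satisfy the same two-term recurrence.  The case k = n + 1, where
    the left side vanishes, yields the annihilating polynomial. *)
Lemma path_vertex_fib (F : fieldType) n k :
    2 \in [pchar F] -> (k <= n.+2)%N ->
  path_vertex F n.+1 k
    = path_vertex F n.+1 1 *m horner_mx (path_adjmx F n.+1) (fib F k).
Proof.
move=> char2; elim/ltn_ind: k => -[|[|k]] IH le_k.
- by rewrite rmorph0 mulmx0; apply/rowP=> j; rewrite !mxE.
- by rewrite rmorph1 mulmx1.
rewrite fibSS rmorphD mulmxDr mulrC mul_horner_mxM /= horner_mx_X.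
rewrite -(IH k.+1) ?(ltnW le_k) // -(IH k) ?(ltnW (ltnW le_k)) //.
rewrite path_vertex_adj //; apply/rowP=> j.
by rewrite !mxE addrAC addrr_pchar2 // add0r.
Qed.

Lemma path_cyclic (F : fieldType) n : 2 \in [pchar F] ->
  cyclic_with (path_adjmx F n.+1) (path_vertex F n.+1 1) (fib F n.+2).
Proof.
move=> char2; split; first exact: size_fib.
  rewrite -path_vertex_fib //; apply/rowP=> j; rewrite !mxE eqSS.
  by rewrite gtn_eqF.
move=> w; exists (\sum_(i < n.+1) w 0 i *: fib F i.+1).
rewrite rmorph_sum mulmx_sumr [LHS]row_sum_delta; apply: eq_bigr => i _.
rewrite /= horner_mxZ -scalemxAr /=; congr (_ *: _).
rewrite -[RHS](path_vertex_fib char2 (leqW (ltn_ord i))).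
apply/rowP=> j; rewrite !mxE eqSS.
by rewrite eqxx eq_sym.
Qed.

Lemma mulmx3E (F : fieldType) m n p q (A : 'M[F]_(m, n)) (X : 'M[F]_(n, p))
    (B : 'M[F]_(p, q)) i j :
  (A *m X *m B) i j = \sum_k \sum_l A i k * X k l * B l j.
Proof.
rewrite exchange_big /= mxE; apply: eq_bigr => l _.
by rewrite mxE mulr_suml.
Qed.

(** Horizontal and vertical neighbours contribute X P and P X respectively, and
    the diagonal contributes X. *)
Lemma grid_kernel (F : fieldType) n (v : 'rV[F]_#|{: 'I_n * 'I_n}|) :
    2 \in [pchar F] ->
    let X : 'M_n := \matrix_(i, j) v 0 (enum_rank (i, j)) in
  (v *m (adjmx F (@grid_adj n) + 1%:M)^T == 0)
    = (path_adjmx F n *m X == X *m (path_adjmx F n - 1%:M)).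
Proof.
move=> char2 X.
have entry i j : (v *m (adjmx F (@grid_adj n) + 1%:M)^T) 0 (enum_rank (i, j))
    = (path_adjmx F n *m X - X *m (path_adjmx F n - 1%:M)) i j.
  have -> : path_adjmx F n *m X - X *m (path_adjmx F n - 1%:M)
      = path_adjmx F n *m X *m 1%:M + 1%:M *m X *m path_adjmx F n + X.
    rewrite mulmxBr !mulmx1 mul1mx opprB addrCA addrC; congr (_ + _ + _).
    by apply/matrixP=> i' j'; rewrite mxE oppr_pchar2.
  rewrite linearD /= trmx1 mulmxDr mulmx1 mxE [RHS]mxE [X i j]mxE.
  congr (_ + _); rewrite mxE [RHS]mxE !mulmx3E -big_split /=.
  rewrite (reindex _ (onW_bij _ (@enum_rank_bij _))) /=.
  transitivity (\sum_i' \sum_j' v 0 (enum_rank (i', j'))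
     * (grid_adj (i, j) (i', j'))%:R).
    rewrite pair_bigA /=; apply: eq_bigr => -[i' j'] _.
    by rewrite !mxE !enum_rankK.
  apply: eq_bigr => i' _; rewrite -big_split /=; apply: eq_bigr => j' _.
  rewrite !mxE -mulrA mulrCA [X in _ = _ + X]mulrAC [X in _ = _ + X]mulrC.
  rewrite -mulrDr; congr (_ * _).
  rewrite -!natrM -natrD; congr _%:R; rewrite /grid_adj /= -!(inj_eq val_inj) /=.
  move: (i : nat) (j : nat) (i' : nat) (j' : nat) => a b c e.
  by have [->|] := altP (a =P c); have [->|] := altP (e =P b);
    rewrite ?muln0 ?mul0n; lia.
apply/eqP/eqP=> [v0|/eqP].
  apply/eqP; rewrite -subr_eq0; apply/eqP/matrixP=> i j.
  by rewrite -entry v0 !mxE.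
rewrite -subr_eq0 => /eqP X0; apply/rowP=> t; rewrite -[t]enum_valK.
by case: (enum_val t) => i j; rewrite entry X0 !mxE.
Qed.

(** * The nullity of the grid *)

Definition shiftp (F : fieldType) (p : {poly F}) : {poly F} := p \Po ('X - 1%:P).

(** An intertwiner X of P and P - 1 is carried to its first row, which is
    multiplication of the grid vector by the coordinate matrix [K]. *)
Lemma nullity_grid (F : fieldType) n : 2 \in [pchar F] ->
  nullity (adjmx F (@grid_adj n.+1) + 1%:M)
    = (size (gcdp (fib F n.+2) (shiftp (fib F n.+2)))).-1.
Proof.
move=> char2; have Pcyc := path_cyclic n char2.
rewrite -(rank_kermx_horner Pcyc) -horner_mx_shift /nullity.
set P := path_adjmx F n.+1 in Pcyc *; set e := path_vertex F n.+1 1 in Pcyc *.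
pose X (v : 'rV[F]_#|{: 'I_n.+1 * 'I_n.+1}|) : 'M_n.+1 :=
  \matrix_(i, j) v 0 (enum_rank (i, j)).
pose K : 'M[F]_(#|{: 'I_n.+1 * 'I_n.+1}|, n.+1) :=
  \matrix_(t, j) (t == enum_rank (ord0, j))%:R.
have mulK v : v *m K = e *m X v.
  apply/rowP=> j; rewrite !mxE (bigD1 (enum_rank (ord0, j))) //= !mxE eqxx mulr1.
  rewrite big1 => [|t /negPf t_neq]; last by rewrite mxE t_neq mulr0.
  rewrite [RHS](bigD1 ord0) //= !mxE mul1r [X in _ = _ + X]big1 // => i i_neq0.
  by rewrite !mxE eqSS eq_sym (negPf i_neq0 : (i == 0 :> nat)%N = false) mul0r.
have PX v : v *m (adjmx F (@grid_adj n.+1) + 1%:M)^T = 0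
    <-> P *m X v = X v *m (P - 1).
  by split=> /eqP h; apply/eqP; move: h; rewrite (grid_kernel v char2).
case: (Pcyc) => _ e0 gen; apply: (rank_kermx_iso (K := K)) => [v|v|w].
- move=> /PX /(horner_mx_intertwine (fib F n.+2)) E.
  by rewrite mulK -mulmxA -E mulmxA e0 mul0mx.
- move=> /PX PXv; rewrite mulK => eX0.
  suff X0 : X v = 0.
    apply/rowP=> t; rewrite -[t]enum_valK; case: (enum_val t) => i j.
    by have /matrixP/(_ i j) := X0; rewrite !mxE.
  apply/row_matrixP=> i; rewrite row0 rowE; have [q ->] := gen (delta_mx 0 i).
  by rewrite -mulmxA (horner_mx_intertwine q PXv) mulmxA eX0 mul0mx.
move=> /(cyclic_intertwiner Pcyc)[Y PY eY].
pose v : 'rV_#|{: 'I_n.+1 * 'I_n.+1}| :=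
  \row_t Y (enum_val t).1 (enum_val t).2.
have XY : X v = Y by apply/matrixP=> i j; rewrite !mxE enum_rankK.
by exists v; [apply/PX; rewrite XY | rewrite mulK XY].
Qed.

(** * Doubling the gcd of a polynomial and its shift *)

Lemma shiftpM (F : fieldType) (p q : {poly F}) :
  shiftp (p * q) = shiftp p * shiftp q.
Proof. exact: comp_polyM. Qed.

Lemma shiftp_XsubC (F : fieldType) (a : F) : shiftp ('X - a%:P) = 'X - (1 + a)%:P.
Proof.
by rewrite /shiftp comp_polyB comp_polyX comp_polyC polyCD opprD addrA.
Qed.

Lemma eqp_lead_coef (F : fieldType) (p q : {poly F}) :
  p %= q -> lead_coef p = lead_coef q -> p = q.
Proof.
move=> eq_pq eq_lc; rewrite (eqpfP eq_pq) eq_lc.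
have [q0|q_neq0] := eqVneq q 0; first by rewrite q0 scaler0.
by rewrite divff ?lead_coef_eq0 // scale1r.
Qed.

Section Char2.

Variable F : fieldType.
Hypothesis char2 : 2 \in [pchar F].

Let add11 : 1 + 1 = 0 :> F. Proof. exact: addrr_pchar2. Qed.

Lemma shiftpK : involutive (@shiftp F).
Proof.
move=> p; rewrite /shiftp -comp_polyA -[X in p \Po X]/(shiftp _) shiftp_XsubC add11.
by rewrite subr0 comp_polyXr.
Qed.

Lemma shiftpX : shiftp 'X = 'X - 1%:P :> {poly F}.
Proof. exact: comp_polyX. Qed.

Lemma shiftpX1 : shiftp ('X - 1%:P) = 'X :> {poly F}.
Proof. by rewrite shiftp_XsubC add11 subr0. Qed.

Lemma root_shiftp0 (p : {poly F}) : root (shiftp p) 0 = root p 1.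
Proof. by rewrite root_comp hornerXsubC sub0r oppr_pchar2. Qed.

(** The shift exchanges p and its shift, so it fixes their gcd up to a scalar;
    the scalar is 1 because the shift preserves leading coefficients. *)
Lemma shiftp_gcdp (p : {poly F}) : shiftp (gcdp p (shiftp p)) = gcdp p (shiftp p).
Proof.
have sizeX1 : (1 < size ('X - 1%:P : {poly F})%R)%N by rewrite size_XsubC.
apply: eqp_lead_coef; last by rewrite lead_coef_comp // lead_coefXsubC expr1n mulr1.
apply: eqp_trans (gcdp_comp_poly _ _ _) _.
by rewrite -![_ \Po _]/(shiftp _) shiftpK gcdpC.
Qed.

(** The factor [g] is then a gcd of [f] and its shift, and [a] and its shift are
    the cofactors. *)
Definition shift_split (f g a : {poly F}) : Prop :=
  [/\ f = g * a, shiftp g = g & coprimep a (shiftp a)].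

Lemma shift_split_exists (f : {poly F}) : f != 0 -> exists g a, shift_split f g a.
Proof.
move=> f_neq0; set g := gcdp f (shiftp f).
have gE : shiftp g = g by apply: shiftp_gcdp.
have fE : f = f %/ g * g by rewrite divpK ?dvdp_gcdl.
have g_neq0 : g != 0 by rewrite gcdp_eq0 negb_and f_neq0.
exists g, (f %/ g); split; rewrite // 1?mulrC //.
have -> : shiftp (f %/ g) = shiftp f %/ g.
  apply: (mulIf g_neq0); rewrite divpK ?dvdp_gcdr //.
  by rewrite -{2}gE -shiftpM -fE.
by apply: coprimep_div_gcd; rewrite f_neq0.
Qed.

Lemma size_gcdp_shift f g a :
  shift_split f g a -> size (gcdp f (shiftp f)) = size g.
Proof.
case=> -> gE co_a; rewrite shiftpM gE (eqp_size (gcdp_mul2l _ _ _)).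
move: co_a; rewrite -gcdp_eqp1 => /(eqp_mull g) /eqp_size ->.
by rewrite mulr1.
Qed.

(** The shift exchanges the only two factors, x - 1 and x, that the cofactors
    x a^2 and (x - 1) (shiftp a)^2 may share.  When a(1) = 0, writing
    a = (x - 1) c moves one copy of each into the gcd and leaves the cofactor
    (x - 1) c^2, so the condition at 1 is inherited. *)
Lemma shift_split_double (f g a : {poly F}) : f != 0 -> shift_split f g a ->
  exists g' a', [/\ shift_split ('X * f ^+ 2) g' a',
    (size g').-1 = (2 * (size g).-1 + 2 * root a 1%R)%N &
    root a' 1 = root a 1].
Proof.
move=> f_neq0 [fE gE co_a].
have g_neq0 : g != 0 by apply: contraNneq f_neq0 => g0; rewrite fE g0 mul0r.
have size_g : (0 < size g)%N by rewrite size_poly_gt0.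
have rootX1 : root ('X : {poly F}) 1 = false by rewrite rootX oner_eq0.
have [a1|a1] := boolP (root a 1); last first.
  exists (g ^+ 2), ('X * a ^+ 2); split.
  - split; first by rewrite fE exprMn mulrCA.
      by rewrite !expr2 shiftpM gE.
    have -> : shiftp ('X * a ^+ 2) = ('X - 1%:P) * shiftp a ^+ 2.
      by rewrite !expr2 !shiftpM shiftpX.
    rewrite !expr2 !(coprimepMl, coprimepMr) co_a !coprimep_XsubC rootX1 a1.
    by rewrite [coprimep 'X _]coprimep_sym coprimepX root_shiftp0 a1.
  - by rewrite expr2 size_mul //; move: (size g) size_g => s; lia.
  by rewrite rootM rootX1 expr2 rootM orbb (negPf a1).
have /factor_theorem[c aE] := a1.
exists (g ^+ 2 * ('X * ('X - 1%:P))), (('X - 1%:P) * c ^+ 2); split.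
- split; first by rewrite fE aE; ring.
    by rewrite expr2 !shiftpM shiftpX1 gE shiftpX ['X * _ in RHS]mulrC.
  move: co_a; rewrite aE expr2 !shiftpM shiftpX1.
  rewrite !(coprimepMl, coprimepMr) => /andP[].
  by move=> /andP[-> ->] /andP[-> ->].
- have X1_neq0 : 'X - 1%:P != 0 :> {poly F} by rewrite polyXsubC_eq0.
  rewrite size_mul ?mulf_neq0 ?expf_neq0 ?polyX_eq0 // expr2 !size_mul ?polyX_eq0 //.
  by rewrite size_polyX size_XsubC; move: (size g) size_g => s; lia.
by rewrite rootM root_XsubC eqxx.
Qed.

End Char2.

(** * From side n to side 2n + 1 *)

Lemma d_split n g a : shift_split (fib 'F_2 n.+2) g a -> d n.+1 = (size g).-1.
Proof.
by move=> fs; rewrite /d nullity_grid ?pchar_Fp // (size_gcdp_shift fs).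
Qed.

(** The splitting of the next polynomial is kept in the conclusion, so that the
    lemma can be applied again at 2n + 1. *)
Lemma delta_split n g a : shift_split (fib 'F_2 n.+2) g a ->
  exists g' a', [/\ shift_split (fib 'F_2 (2 * n.+1).+2) g' a',
    delta n.+1 = 2 * (root a 1)%:Z & root a' 1 = root a 1].
Proof.
have char2 : 2 \in [pchar 'F_2] by rewrite pchar_Fp.
move=> fs; have f_neq0 : fib 'F_2 n.+2 != 0 by rewrite -size_poly_eq0 size_fib.
have [g' [a' [fs' sz ra]]] := shift_split_double char2 f_neq0 fs.
have eqn : ((2 * n.+1).+2 = 2 * n.+2)%N by lia.
have fs2 : shift_split (fib 'F_2 (2 * n.+1).+2) g' a' by rewrite eqn fib_double.
exists g', a'; split=> //.
rewrite /delta addn1 (d_split fs2) (d_split fs) sz.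
by move: (size g).-1 (root a 1) => k b; lia.
Qed.

Theorem theorem3p1 :
  forall n : nat, (0 < n)%N ->
    (delta n = 0 \/ delta n = 2) /\ delta (2 * n + 1)%N = delta n.
Proof.
case=> // n _.
have f_neq0 : fib 'F_2 n.+2 != 0 by rewrite -size_poly_eq0 size_fib.
have [g [a fs]] := shift_split_exists (pchar_Fp (isT : prime 2)) f_neq0.
have [g' [a' [fs' -> <-]]] := delta_split fs.
split; first by case: (root a' 1); [right | left].
move: fs'; rewrite addn1 => /delta_split.
by case=> g2 [a2 [_ -> _]].
Qed.
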